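(* Let $B,\bar B$ be real or complex vector spaces and let $L(\varepsilon)=\sum_{i=0}^\infty\varepsilon^iL_i$, $L_i\in L(B,\bar B)$, be a formal power series of linear maps. Assume that the recursion described in the context stabilizes at some $k\ge0$, and define the formal power series $$\phi(\varepsilon)=\sum_{i=0}^\infty\varepsilon^i\phi_i,\qquad \phi_i:=M_{k+1,k+1+i}\in L(B,B).$$ (i) By Cauchy product, $\phi(\varepsilon)$ transforms $L(\varepsilon)$ into $$S(\varepsilon):=L(\varepsilon)\cdot\phi(\varepsilon)=S_1+\varepsilon S_2+\cdots+\varepsilon^kS_{k+1}+\sum_{l=2}^\infty\varepsilon^{k+l-1}S_{k+l},$$ where for $i=1,\dots,k+1$ $$S_i(N_0^c+\cdots+N_{i-1}^c)\subset R_{i-1}^c,\qquad S_iN_i^c=R_i,\qquad S_iN_i=0,$$ and for $l\ge2$ $$R[S_{k+l}]\subset R_{k+1}^c,\qquad S_{k+l}N_{k+1}=0$$ (so that, with respect to $B=N_1^c\oplus\cdots\oplus N_{k+1}^c\oplus N_{k+1}$ and $\bar B=R_1\oplus\cdots\oplus R_{k+1}\oplus R_{k+1}^c$, the only possibly nonzero blocks of $S_{k+l}$, $l\geq 2$, are those from $N_1^c,\dots,N_{k+1}^c$ into $R_{k+1}^c$). In particular, $S_{i+1}N_{k+1}=0$ for all $i\ge0$. (ii) For every formal power series $b(\varepsilon)=\sum_{i=0}^\infty\varepsilon^ib_i$, $b_i\in B$, with $L(\varepsilon)\cdot b(\varepsilon)=0$ there exists a unique formal power series $n_{k+1}(\varepsilon)=\sum_{i=0}^\infty\varepsilon^in_{k+1}^i$,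 $n_{k+1}^i\in N_{k+1}$, with $b(\varepsilon)=\phi(\varepsilon)\cdot n_{k+1}(\varepsilon)$, and its coefficients are recursively determined by $$n_{k+1}^0=b_0,\qquad n_{k+1}^i=b_i-\sum_{j=1}^i\phi_j\,n_{k+1}^{i-j},\quad i\ge1.$$ (iii) The set of all formal power series solutions $b(\varepsilon)=\sum_i\varepsilon^ib_i$ of $L(\varepsilon)\cdot b(\varepsilon)=0$ is given by $$X_\infty:=\Big\{(b_i)_{i\in\mathbb N_0}\ \Big|\ b_i=\sum_{j=0}^i\phi_j\,n_{k+1}^{i-j},\ n_{k+1}^i\in N_{k+1}\Big\},\qquad \phi_0=I_B.$$ (iv) The power series $S(\varepsilon)=\sum_{i=0}^\infty\varepsilon^iS_{i+1}$ from (i) can be factorized by a formal power series $\psi(\varepsilon)=I_{\bar B}+\sum_{i=1}^\infty\varepsilon^i\psi_i$, $\psi_i\in L(\bar B,\bar B)$, and a diagonal operator polynomial $\Delta(\varepsilon)$ according to $$S(\varepsilon)=\psi(\varepsilon)\cdot\Delta(\varepsilon)=\Big[I_{\bar B}+\sum_{i=1}^\infty\varepsilon^i\psi_i\Big]\cdot\big[S_1P_1+\varepsilon S_2P_2+\cdots+\varepsilon^kS_{k+1}P_{k+1}\big],$$ where $P_1,\dots,P_{k+1}$ denote the projections onto $N_1^c,\dots,N_{k+1}^c$.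
   Context: Notation. $L(B,\bar B)$ denotes linear maps (not necessarily bounded), $N[T]$ and $R[T]$ the kernel and range of $T$, $I_B$ and $I_{\bar B}$ identities. Products of formal power series are Cauchy products. Recursion. Set $N_0:=B$, $N_0^c:=\{0\}$, $R_0:=\{0\}$, $R_0^c:=\bar B$, $\bar S_1:=S_1:=L_0$, $N_1:=N[S_1]$, $R_1:=R[S_1]$; let $N_1^c$ be a chosen (algebraic) complement of $N_1$ in $N_0$ and $R_1^c$ a chosen complement of $R_1$ in $R_0^c$. Set $M_1:=M^{(1)}:=I_B$. For $k\ge1$, given the upper triangular operator matrix $M^{(k)}$ ($k\times k$, entries in $L(B,B)$) with last column $M_k$, define $$\bar S_{k+1}:=(L_1\ \cdots\ L_k)\cdot M_k,\qquad S_{k+1}:=P_{R_k^c}\bar S_{k+1},$$ where $P_{R_k^c}$ is the projection of $\bar B=R_1\oplus\cdots\oplus R_k\oplus R_k^c$ onto $R_k^c$ along $R_1\oplus\cdots\oplus R_k$. Put $N_{k+1}:=N[S_{k+1}|_{N_k}]$, $R_{k+1}:=R[S_{k+1}|_{N_k}]$; let $N_{k+1}^c$ be a chosen complement of $N_{k+1}$ in $N_k$ and $R_{k+1}^c$ a chosen complement of $R_{k+1}$ in $R_k^c$. This gives $B=N_1^c\oplus\cdots\oplus N_{k+1}^c\oplus N_{k+1}$ and $\bar B=R_1\oplus\cdots\oplus R_{k+1}\oplus R_{k+1}^c$. Let $P_i$ and $\mathcal P_i$ be the projections onto $N_i^c$ and $R_i$ with respect to these direct sums. $S_i$ restricts to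 a bijection $N_i^c\to R_i$, and $S_i^{-1}:R_i\to N_i^c$ denotes its inverse. Define an operator column $E_{k+1}=(E_{1,k+1},\dots,E_{k+1,k+1})^T$ from bottom to top by $$E_{k+1,k+1}:=I_B,\qquad E_{i,k+1}:=-S_i^{-1}\mathcal P_i\sum_{\nu=i+1}^{k+1}\bar S_\nu E_{\nu,k+1},\quad i=k,\dots,1,$$ then the column $$M_{k+1}=(M_{1,k+1},\dots,M_{k+1,k+1})^T:=\begin{pmatrix}I_B&0\\0&M^{(k)}\end{pmatrix}E_{k+1},$$ and let $M^{(k+1)}$ be the $(k+1)\times(k+1)$ upper triangular matrix whose columns are $M_1,\dots,M_{k+1}$ (filled up with zeros below). One has $M_{i,i}=I_B$. Stabilization at $k\ge0$ means $R_{k+1}\ne\{0\}$ and $R_{k+l}=\{0\}$ for all $l\ge2$ (equivalently $N_k\supsetneq N_{k+1}=N_{k+l}$ for all $l\ge1$). *)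

(* Defs.v *)
From HB Require Import structures.
From mathcomp Require Import all_boot all_order all_algebra.
From mathcomp Require Import boolp classical_sets.

Set Implicit Arguments.
Unset Strict Implicit.
Unset Printing Implicit Defensive.

Import GRing.Theory.
Local Open Scope classical_set_scope.
Local Open Scope ring_scope.

(* Subspaces of possibly infinite-dimensional spaces are classical sets. *)
Definition setadd (V : zmodType) (A C : set V) : set V :=
  [set a + c | a in A & c in C].

Definition is_complement (K : fieldType) (V : lmodType K) (W A C : set V) :=
  [/\ submod_closed [in C], A `&` C = [set 0] & setadd A C = W].

(* The projection onto A along C. It is a total function, meaningful on A + C
   when A and C are subspaces with trivial intersection. *)
Definition proj (V : zmodType) (A C : set V) (x : V) : V :=
  xget 0 [set y | A y /\ C (x - y)].

(* The projection onto A_i with respect to A_1 + ... + A_m + C_m. *)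
Definition proj_summand (V : zmodType) (A C : nat -> set V) (m i : nat) :
    V -> V :=
  proj (A i)
    (setadd (\big[@setadd V/[set 0]]_(1 <= j < m.+1 | j != i) A j) (C m)).

(* The inverse of the restriction of f to A, meaningful on the image of A
   when f is injective on A. *)
Definition inv_on (U V : zmodType) (f : U -> V) (A : set U) (y : V) : U :=
  xget 0 [set x | A x /\ f x = y].

(* A formal power series is the sequence of its coefficients;
   [ps_app] and [ps_comp] are the Cauchy products operator-vector and
   operator-operator. *)
Definition ps_app (U V : zmodType) (F : nat -> U -> V) (b : nat -> U) :
    nat -> V :=
  fun n => \sum_(0 <= i < n.+1) F i (b (n - i)%N).

Definition ps_comp (U V W : zmodType) (F : nat -> V -> W) (G : nat -> U -> V) :
    nat -> U -> W :=
  fun n x => \sum_(0 <= i < n.+1) F i (G (n - i)%N x).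

(* A run of the recursion for L(eps) = sum_i eps^i L_i. The sequences [Nc_] and
   [Rc_] carry the free choices of complements; everything else is determined
   by the equations. Indices are those of the mathematical text, hence [S_],
   [Sbar_], [M_] and [E_] are only constrained at indices >= 1 ([E_] at columns
   >= 2). The entry (i, j) of the matrix M^(k) is [M_ i j] for every k >= i, j,
   since M^(k+1) extends M^(k). The operators are bare functions, so that their
   linearity is a consequence of the equations and not an assumption. *)
Record recursion (K : fieldType) (B B' : lmodType K)
    (L : nat -> {linear B -> B'}) := Recursion {
  N_ : nat -> set B;
  Nc_ : nat -> set B;
  R_ : nat -> set B';
  Rc_ : nat -> set B';
  Sbar_ : nat -> B -> B';
  S_ : nat -> B -> B';
  E_ : nat -> nat -> B -> B;
  M_ : nat -> nat -> B -> B;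
  N_0 : N_ 0%N = setT;
  Nc_0 : Nc_ 0%N = [set 0];
  R_0 : R_ 0%N = [set 0];
  Rc_0 : Rc_ 0%N = setT;
  Sbar_1 : forall x, Sbar_ 1%N x = L 0%N x;
  S_1 : forall x, S_ 1%N x = Sbar_ 1%N x;
  M_1 : forall x, M_ 1%N 1%N x = x;
  Sbar_succ : forall k x, (0 < k)%N ->
    Sbar_ k.+1 x = \sum_(1 <= r < k.+1) L r (M_ r k x);
  S_succ : forall k x, (0 < k)%N ->
    S_ k.+1 x =
      proj (Rc_ k) (\big[@setadd B'/[set 0]]_(1 <= j < k.+1) R_ j)
        (Sbar_ k.+1 x);
  (* With N_0 = B, the instance k = 0 reads N_1 = N[S_1], R_1 = R[S_1]. *)
  N_succ : forall k, N_ k.+1 = [set x | N_ k x /\ S_ k.+1 x = 0];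
  R_succ : forall k, R_ k.+1 = S_ k.+1 @` N_ k;
  Nc_succ : forall k, is_complement (N_ k) (N_ k.+1) (Nc_ k.+1);
  Rc_succ : forall k, is_complement (Rc_ k) (R_ k.+1) (Rc_ k.+1);
  E_diag : forall k x, (0 < k)%N -> E_ k.+1 k.+1 x = x;
  E_up : forall k i x, (0 < i <= k)%N ->
    E_ i k.+1 x =
      - inv_on (S_ i) (Nc_ i)
          (proj_summand R_ Rc_ k.+1 i
             (\sum_(i.+1 <= nu < k.+2) Sbar_ nu (E_ nu k.+1 x)));
  M_first : forall k x, (0 < k)%N -> M_ 1%N k.+1 x = E_ 1%N k.+1 x;
  M_succ : forall k i x, (0 < i <= k)%N ->
    M_ i.+1 k.+1 x = \sum_(1 <= j < k.+1) M_ i j (E_ j.+1 k.+1 x);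
  M_lower : forall i j x, (0 < j < i)%N -> M_ i j x = 0
}.

Section Series.
Variables (K : fieldType) (B B' : lmodType K).
Variables (L : nat -> {linear B -> B'}) (D : recursion L) (k : nat).

Definition stabilizes_at :=
  R_ D k.+1 <> [set 0] /\
  (forall l, (2 <= l)%N -> R_ D (k + l)%N = [set 0]).

Definition phi (i : nat) : B -> B := M_ D k.+1 (k.+1 + i)%N.

Definition PN (i : nat) : B -> B := proj_summand (Nc_ D) (N_ D) k.+1 i.

Definition PR (i : nat) : B' -> B' := proj_summand (R_ D) (Rc_ D) k.+1 i.

Definition Delta (i : nat) (x : B) : B' :=
  if (i <= k)%N then S_ D i.+1 (PN i.+1 x) else 0.

Definition solutions : set (nat -> B) :=
  [set b | forall n, ps_app (fun i => L i) b n = 0].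

Definition X_infty : set (nat -> B) :=
  [set b | exists n : nat -> B, (forall i, N_ D k.+1 (n i)) /\
     forall i, b i = \sum_(0 <= j < i.+1) phi j (n (i - j)%N)].

End Series.

(* Main.v *)
Require Import Defs.
From HB Require Import structures.
From mathcomp Require Import all_boot all_order all_algebra.
From mathcomp Require Import boolp classical_sets.
From mathcomp Require Import zify.

Import GRing.Theory.
Local Open Scope classical_set_scope.
Local Open Scope ring_scope.

Set Implicit Arguments.
Unset Strict Implicit.
Unset Printing Implicit Defensive.

(** Throughout, a direct sum V = A_1 + ... + A_m + C_m arises from repeatedly
splitting the current remainder C_j as A_(j+1) + C_(j+1). The projection onto
C_m is therefore an iterated one, [remainder m], and the projection onto A_i is
the difference [component i] of two consecutive remainders. In the recursion
this applies to R_j, R_j^c in the target and to N_j^c, N_j in the source; that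
all operators are linear follows by induction along the recursion
([linear_upto_all]), because each stage only projects with respect to sums
already known to be direct.

The columns E_n are built so that adding the terms Sbar_nu E_(nu,n), nu < n, to
Sbar_n removes its components in R_1, ..., R_(n-1); what is left is S_n ([S_Sbar_E]). Expanding
Sbar and using the definition of M turns this into
sum_r L_r M_(r+1,n) = S_n ([S_column]). Moving one step down a diagonal of M
changes an entry by terms ending in some E_(j+1,n+1), whose values lie in N_j,
and the total change is a sum of S_i's with i <= j, which vanish there. So the
identity persists along every diagonal ([S_diagonal]). After
stabilization N_i^c = 0 for i > k+1, hence E_(i,n) = 0 for k+1 < i < n, and the
diagonals of M become constant from row k+1 on ([M_stable]). The shifted
identity then reads L phi = S ([L_phi]).

Since phi_0 is the identity, every b is phi n for exactly one series n, and
L b = 0 amounts to S n = 0. As S_(m+1) maps N_m to R_(m+1) while all later S_j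
take values in R_(m+1)^c, the equation S n = 0 pushes the coefficients of n
through N_1, N_2, ... down to N_(k+1) ([S_series_kernel]); conversely all S_j
vanish on N_(k+1) ([stable_S_N0]). Finally S maps x in N_p^c to
eps^(p-1) (S_p x + eps S_(p+1) x + ...), so that psi only has to send S_p x to
S_p x + eps S_(p+1) x + ... ([psi_S]), which is consistent as S_p is injective
on N_p^c. *)

(** * Finite sums and formal power series *)

Section PowerSeries.

Lemma sum_nat_trim (V : zmodType) a m n (F : nat -> V) : (a <= m <= n)%N ->
  (forall i, (m <= i < n)%N -> F i = 0) ->
  \sum_(a <= i < n) F i = \sum_(a <= i < m) F i.
Proof.
move=> /andP[am mn] h; rewrite (big_cat_nat am mn) /=.
by rewrite [X in _ + X]big_nat [X in _ + X]big1 ?addr0.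
Qed.

Variables U V W : zmodType.

(** Associativity of the Cauchy product. *)
Lemma ps_app_app (F : nat -> {additive V -> W}) (G : nat -> U -> V)
    (n : nat -> U) m :
  ps_app (fun i => F i) (ps_app G n) m = ps_app (ps_comp (fun i => F i) G) n m.
Proof.
rewrite /ps_app /ps_comp.
transitivity (\sum_(0 <= i < m.+1) \sum_(0 <= p < m.+1 | (i <= p)%N)
    F i (G (p - i)%N (n (m - p)%N))).
  apply: eq_big_nat => i hi; rewrite raddf_sum.
  rewrite [RHS](_ : _ =
    \sum_(0 + i <= p < m.+1) F i (G (p - i)%N (n (m - p)%N))).
    rewrite big_addn -subSn; last lia.
    apply: eq_big_nat => j hj; rewrite addnK.
    by congr (F i (G j (n _))); lia.
  by rewrite add0n [RHS](@big_nat_widenl _ _ _ i 0).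
rewrite (exchange_big_dep_nat xpredT) //=; apply: eq_big_nat => p hp.
by rewrite [RHS](@big_nat_widen _ _ _ 0 p.+1 m.+1) //; lia.
Qed.

Variable G : nat -> U -> U.
Hypothesis G0 : forall x, G 0%N x = x.

Lemma ps_app_recl n i :
  ps_app G n i = n i + \sum_(1 <= j < i.+1) G j (n (i - j)%N).
Proof. by rewrite /ps_app big_ltn // G0 subn0. Qed.

Lemma ps_app_solve (b : nat -> U) : exists n, forall i, b i = ps_app G n i.
Proof.
(* [pre m] holds the first m coefficients of the solution. *)
pose pre := fix pre m : nat -> U := if m is p.+1 then
  fun i => if i == p then b p - \sum_(1 <= j < p.+1) G j (pre p (p - j)%N)
           else pre p i else fun=> 0.
have pre_stable m i : (i < m)%N -> pre m i = pre i.+1 i.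
  elim: m => // m IH im /=; case: eqVneq => [-> //|ne].
    by rewrite eqxx.
  by rewrite IH //; lia.
exists (fun i => pre i.+1 i) => i; rewrite ps_app_recl.
rewrite [pre i.+1 i]/= eqxx.
rewrite -[LHS](subrK (\sum_(1 <= j < i.+1) G j (pre i (i - j)%N))).
congr (_ + _); apply: eq_big_nat => j hj; congr (G j _).
by apply: pre_stable; lia.
Qed.

Lemma ps_app_inj n n' : (forall i, ps_app G n i = ps_app G n' i) -> n = n'.
Proof.
move=> e; apply/funext => i; have [m] := ubnP i; elim: m i => // m IH i im.
have := e i; rewrite !ps_app_recl => h.
rewrite [X in _ + X = _](eq_big_nat _ _
  (F2 := fun j => G j (n' (i - j)%N))) in h; first exact: addIr h.
by move=> j hj; rewrite IH //; lia.
Qed.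

End PowerSeries.

(** * Linear functions and subspaces *)

Section Linear.
Variable K : fieldType.
Implicit Types U V W : lmodType K.

Definition linear_of U V (f : U -> V) (hf : linear f) : {linear U -> V} :=
  HB.pack f (GRing.isLinear.Build K U V _ f hf).

Lemma linear_at0 U V (f : U -> V) : linear f -> f 0 = 0.
Proof. by move=> hf; exact: (raddf0 (linear_of hf)). Qed.

Lemma linear_atD U V (f : U -> V) x y : linear f -> f (x + y) = f x + f y.
Proof. by move=> hf; exact: (raddfD (linear_of hf)). Qed.

Lemma linear_atB U V (f : U -> V) x y : linear f -> f (x - y) = f x - f y.
Proof. by move=> hf; exact: (raddfB (linear_of hf)). Qed.

Lemma linear_at_sum U V (f : U -> V) I (r : seq I) (P : pred I) (F : I -> U) :
  linear f -> f (\sum_(i <- r | P i) F i) = \sum_(i <- r | P i) f (F i).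
Proof. by move=> hf; exact: (raddf_sum (linear_of hf)). Qed.

Lemma linear_compose U V W (f : V -> W) (g : U -> V) :
  linear f -> linear g -> linear (fun x => f (g x)).
Proof. by move=> hf hg a x y; rewrite hg hf. Qed.

Lemma linear_sub U V (f g : U -> V) :
  linear f -> linear g -> linear (fun x => f x - g x).
Proof.
by move=> hf hg a x y; rewrite hf hg scalerBr opprD addrACA.
Qed.

Lemma linear_opp U V (f : U -> V) : linear f -> linear (fun x => - f x).
Proof. by move=> hf a x y; rewrite hf opprD scalerN. Qed.

Lemma linear_sum_nat U V m n (F : nat -> U -> V) :
  (forall i, (m <= i < n)%N -> linear (F i)) ->
  linear (fun x => \sum_(m <= i < n) F i x).
Proof.
move=> hF a x y; rewrite scaler_sumr -big_split /=.
by apply: eq_big_nat => i /hF ->.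
Qed.

Lemma linear_ext U V (f g : U -> V) : f =1 g -> linear g -> linear f.
Proof. by move=> fg hg a x y; rewrite !fg hg. Qed.

Definition subspace V (W : set V) :=
  W 0 /\ forall a x y, W x -> W y -> W (a *: x + y).

Lemma subspaceD V (W : set V) x y : subspace W -> W x -> W y -> W (x + y).
Proof. by case=> _ h hx hy; rewrite -[x]scale1r; apply: h. Qed.

Lemma subspaceN V (W : set V) x : subspace W -> W x -> W (- x).
Proof. by case=> h0 h hx; rewrite -scaleN1r -[_ *: _]addr0; apply: h. Qed.

Lemma subspaceB V (W : set V) x y : subspace W -> W x -> W y -> W (x - y).
Proof. by move=> h hx hy; apply: subspaceD => //; apply: subspaceN. Qed.

Lemma subspace_kernel U V (f : U -> V) (W : set U) :
  subspace W -> linear f -> subspace [set x | W x /\ f x = 0].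
Proof.
move=> [h0 h] hf; split=> [|a x y [wx fx] [wy fy]] /=.
  by rewrite (linear_at0 hf).
by split; [exact: h | rewrite hf fx fy scaler0 addr0].
Qed.

Lemma subspace_image U V (f : U -> V) (W : set U) :
  subspace W -> linear f -> subspace (f @` W).
Proof.
move=> [h0 h] hf; split=> [|a _ _ [x wx <-] [y wy <-]] /=.
  by exists 0 => //; exact: linear_at0.
by exists (a *: x + y); [exact: h | rewrite hf].
Qed.

Lemma subspace_submod V (W : set V) : submod_closed [in W] -> subspace W.
Proof.
case; rewrite /= in_setE => h0 h; split=> // a x y wx wy.
by have := h a x y; rewrite /= !in_setE; apply.
Qed.

Lemma inv_onP U V (f : U -> V) (A : set U) y :
  (f @` A) y -> A (inv_on f A y) /\ f (inv_on f A y) = y.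
Proof.
by case=> x ax fx; apply: (@xgetPex _ 0 [set x | A x /\ f x = y]); exists x.
Qed.

(** The inverse by itself is additive on the image of A only; composing it with
a linear map into that image gives a map that is linear everywhere. *)
Lemma linear_inv_on U V W (f : U -> V) (A : set U) (g : W -> V) :
  linear f -> subspace A -> (forall x, A x -> f x = 0 -> x = 0) ->
  linear g -> (forall x, (f @` A) (g x)) ->
  linear (fun x => inv_on f A (g x)).
Proof.
move=> hf sA inj hg hin a x y; have [_ hA] := sA.
have [a1 f1] := inv_onP (hin x); have [a2 f2] := inv_onP (hin y).
have [a3 f3] := inv_onP (hin (a *: x + y)).
apply/eqP; rewrite -subr_eq0; apply/eqP; apply: inj.
  by apply: subspaceB => //; apply: hA.
by rewrite (linear_atB _ _ hf) hf f1 f2 f3 hg subrr.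
Qed.

Lemma setadd_big_sub V (A : nat -> set V) (r : seq nat) (P : pred nat)
    (W : set V) :
  subspace W -> (forall j, j \in r -> P j -> A j `<=` W) ->
  \big[@setadd V/[set 0]]_(j <- r | P j) A j `<=` W.
Proof.
move=> sW h; rewrite big_seq_cond.
apply: (big_ind (fun X => X `<=` W)) => [_ ->|X Y hX hY|j /andP[]].
- by case: sW.
- by move=> _ [x xX] [y yY] <-; apply: subspaceD; [|exact: hX|exact: hY].
- exact: h.
Qed.

Lemma setadd_big_sum V (A : nat -> set V) (r : seq nat) (P : pred nat)
    (a : nat -> V) :
  (forall j, j \in r -> P j -> A j (a j)) ->
  (\big[@setadd V/[set 0]]_(j <- r | P j) A j) (\sum_(j <- r | P j) a j).
Proof.
move=> h; rewrite big_seq_cond [X in _ X]big_seq_cond.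
apply: (big_ind2 (fun x (X : set V) => X x)) => // [x X y Y xX yY|j /andP[]].
  by exists x => //; exists y.
exact: h.
Qed.

(** A linear map which is the identity on A and vanishes on C detects the
A-part of any decomposition. *)
Lemma proj_eq V (A C : set V) (f : V -> V) x y :
  linear f -> (forall z, A z -> f z = z) -> (forall z, C z -> f z = 0) ->
  A y -> C (x - y) -> proj A C x = y.
Proof.
move=> hf fA fC ay cy.
have f_x z : A z -> C (x - z) -> z = f x.
  move=> az cz; rewrite -[x in RHS](subrK z) (linear_atD _ _ hf) fC //.
  by rewrite add0r fA.
by apply: xget_unique => [|z [az cz]]; last rewrite (f_x z) // (f_x y).
Qed.

End Linear.

(** * Successive splittings *)

Section Flag.
Variables (K : fieldType) (V : lmodType K) (A C : nat -> set V).

Definition split_sum (W X Y : set V) :=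
  [/\ subspace X, subspace Y, X `&` Y = [set 0] & setadd X Y = W].

Lemma split_sum0 W X Y x : split_sum W X Y -> X x -> Y x -> x = 0.
Proof. by case=> _ _ h _ xx yx; have : (X `&` Y) x by []; rewrite h. Qed.

Lemma split_sumL W X Y : split_sum W X Y -> X `<=` W.
Proof.
by case=> _ [h0 _] _ <- x xX; exists x => //; exists 0; rewrite ?addr0.
Qed.

Lemma split_sumR W X Y : split_sum W X Y -> Y `<=` W.
Proof.
by case=> [[h0 _]] _ _ <- x xY; exists 0 => //; exists x; rewrite ?add0r.
Qed.

(** The splitting process is truncated after [n] steps because, in the recursion,
R_(j+1) is known to be a subspace only once S_(j+1) is known to be linear. *)
Definition flag n :=
  C 0%N = setT /\
  forall j, (j < n)%N -> split_sum (C j) (A j.+1) (C j.+1).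

Fixpoint remainder m x :=
  if m is p.+1 then proj (C p.+1) (A p.+1) (remainder p x) else x.

Definition component i x := remainder i.-1 x - remainder i x.

Variable n : nat.
Hypothesis flagn : flag n.

Let spl j : (j < n)%N -> split_sum (C j) (A j.+1) (C j.+1).
Proof. by case: flagn => _; apply. Qed.

(** The induction step of [remainder_in], stated separately for the sake of its
second half. *)
Lemma remainder_step m x : (m < n)%N -> C m (remainder m x) ->
  C m.+1 (remainder m.+1 x) /\ A m.+1 (remainder m x - remainder m.+1 x).
Proof.
move=> mn; have [_ _ _ <-] := spl mn; case=> a aA [c cC e] /=.
apply: (@xgetPex _ 0 [set y | C m.+1 y /\ A m.+1 (remainder m x - y)]).
by exists c; split=> //=; rewrite -e addrK.
Qed.

Lemma remainder_in m x : (m <= n)%N -> C m (remainder m x).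
Proof.
elim: m => [_|m IH mn]; first by case: flagn => ->.
by have [] := remainder_step mn (IH (ltnW mn)).
Qed.

Lemma component_in i x : (0 < i <= n)%N -> A i (component i x).
Proof.
case: i => // m mn; have [_] := remainder_step mn (remainder_in x (ltnW mn)).
by [].
Qed.

Lemma flag_subspace m : (m <= n)%N -> subspace (C m).
Proof. by case: m => [_|m /spl[]//]; case: flagn => ->. Qed.

Lemma flag_subspaceA m : (0 < m <= n)%N -> subspace (A m).
Proof. by case: m => // m /spl[]. Qed.

(** A single projection is linear on A + C only; here it is applied to
[remainder m x], which lies in C_m = A_(m+1) + C_(m+1), so the defect of
linearity of the next remainder lies both in A_(m+1) and in C_(m+1). *)
Lemma remainder_linear m : (m <= n)%N -> linear (remainder m).
Proof.
elim: m => [//|m IH mn] a x y; have hm := IH (ltnW mn).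
have r z := remainder_step mn (remainder_in z (ltnW mn)).
have [sA sC _ _] := spl mn; have [_ lA] := sA; have [_ lC] := sC.
have [c1 a1] := r x; have [c2 a2] := r y; have [c3 a3] := r (a *: x + y).
apply/eqP; rewrite -subr_eq0; apply/eqP/(split_sum0 (spl mn)); last first.
  by apply: (subspaceB sC) => //; apply: lC.
have -> : remainder m.+1 (a *: x + y) -
    (a *: remainder m.+1 x + remainder m.+1 y) =
    (a *: (remainder m x - remainder m.+1 x) +
     (remainder m y - remainder m.+1 y)) -
    (remainder m (a *: x + y) - remainder m.+1 (a *: x + y)).
  by rewrite hm scalerBr [in RHS]addrACA -opprD opprB [RHS]addrC addrA subrK.
by apply: (subspaceB sA) => //; apply: lA.
Qed.

Lemma component_linear i : (0 < i <= n)%N -> linear (component i).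
Proof.
move=> hi; apply: linear_sub; apply: remainder_linear; lia.
Qed.

Lemma flag_anti i j : (i <= j <= n)%N -> C j `<=` C i.
Proof.
case/andP=> /subnK <-; elim: (j - i)%N => [_ x //|d IH].
rewrite addSn => h; apply: subset_trans (IH (ltnW h)).
exact: split_sumR (spl h).
Qed.

Lemma flag_sub i j : (i < j <= n)%N -> A j `<=` C i.
Proof.
case: j => [//|j] h; apply: (subset_trans (B := C j)).
  by apply: split_sumL (spl _); lia.
apply: flag_anti; lia.
Qed.

Lemma remainder_id m x : (m <= n)%N -> C m x -> remainder m x = x.
Proof.
elim: m x => [//|m IH] x mn cx.
have hx : remainder m x = x.
  by apply: IH; [lia | apply: flag_anti cx; lia].
have [c a] := remainder_step mn (remainder_in x (ltnW mn)).
apply/esym/eqP; rewrite -subr_eq0; apply/eqP/(split_sum0 (spl mn)).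
  by rewrite -[X in X - _]hx.
by apply: subspaceB => //; case: (spl mn).
Qed.

(** At step i the element x of A_i is still its own remainder, so that the next
remainder lies in A_i as well as in C_i. *)
Lemma remainder0 m i x : (0 < i <= m)%N -> (m <= n)%N -> A i x ->
  remainder m x = 0.
Proof.
move=> im mn ax; elim: m im mn => [|m IH] im mn; first lia.
have [c a] := remainder_step mn (remainder_in x (ltnW mn)).
apply: (split_sum0 (spl mn) _ c); have [sA _ _ _] := spl mn.
rewrite -[remainder _ _]opprK; apply: subspaceN => //.
have [e|ne] := eqVneq i m.+1; last first.
  by move: a; rewrite IH ?sub0r //; lia.
move: a; rewrite (@remainder_id m x) ?(ltnW mn) //; last first.
  by apply: flag_sub ax; lia.
move=> a; have -> : - remainder m.+1 x = (x - remainder m.+1 x) - x.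
  by rewrite addrAC subrr sub0r.
by apply: subspaceB => //; rewrite -e.
Qed.

(** The difference [remainder p x - x] is a sum of elements of A_1, ..., A_p,
which all die in the m-th remainder. *)
Lemma remainder_remainder p m x : (p <= m <= n)%N ->
  remainder m (remainder p x) = remainder m x.
Proof.
move=> pmn; apply/eqP; rewrite -subr_eq0 -linear_atB; last first.
  by apply: remainder_linear; lia.
elim: p pmn => [|p IH] pmn.
  by rewrite subrr linear_at0 //; apply: remainder_linear; lia.
have lm : linear (remainder m) by apply: remainder_linear; lia.
have pn : (p < n)%N by lia.
have [_ a] := remainder_step pn (remainder_in x (ltnW pn)).
rewrite -[_ - x](subrKA (remainder p x)) (linear_atD _ _ lm).
rewrite (eqP (IH _)); last lia.
rewrite addr0 -opprB -sub0r (linear_atB _ _ lm) (linear_at0 lm).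
by rewrite (@remainder0 _ p.+1) ?subrr //; lia.
Qed.

Lemma component_id i x : (0 < i <= n)%N -> A i x -> component i x = x.
Proof.
move=> hi ax; rewrite /component (@remainder0 i i) //; try lia.
rewrite subr0 (@remainder_id i.-1) //; (try lia); apply: flag_sub ax; lia.
Qed.

Lemma component0 i j x : (0 < i <= n)%N -> (0 < j <= n)%N -> j != i ->
  A j x -> component i x = 0.
Proof.
move=> hi hj ji ax; rewrite /component.
have [lt|le] := ltnP j i.
  by rewrite (@remainder0 i j) ?(@remainder0 i.-1 j) ?subrr //; lia.
by rewrite !remainder_id ?subrr //; (try lia); apply: flag_sub ax; lia.
Qed.

Lemma component_remainder0 i m x : (0 < i <= m)%N -> (m <= n)%N -> C m x ->
  component i x = 0.
Proof.
move=> im mn cx; rewrite /component !remainder_id ?subrr //; try lia;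
  by apply: flag_anti cx; lia.
Qed.

Lemma component_sum m x :
  x = \sum_(1 <= j < m.+1) component j x + remainder m x.
Proof.
elim: m => [|m IH]; first by rewrite big_geq ?add0r.
by rewrite big_nat_recr //= -addrA subrK -IH.
Qed.

(** As [remainder m] is linear, is the identity on C_m and kills A_1, ..., A_m,
[proj_eq] applies without a separate proof that A_1 + ... + A_m + C_m is direct;
likewise for [component i] below. *)
Lemma proj_remainder m x : (m <= n)%N ->
  proj (C m) (\big[@setadd V/[set 0]]_(1 <= j < m.+1) A j) x = remainder m x.
Proof.
move=> mn; have lm := remainder_linear mn.
apply: (proj_eq lm); first by move=> z; apply: remainder_id.
- have sk : subspace [set z | setT z /\ remainder m z = 0].
    by apply: subspace_kernel.
  move=> z hz.
  suff [] : [set z | setT z /\ remainder m z = 0] z by [].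
  apply: setadd_big_sub hz => // j; rewrite mem_index_iota => hj _ y ay /=.
  by split=> //; apply: remainder0 ay; lia.
- exact: remainder_in.
- rewrite [x in x - _](component_sum m) addrK.
  apply: setadd_big_sum => j; rewrite mem_index_iota => hj _.
  by apply: component_in; lia.
Qed.

Lemma proj_summand_component m i x : (0 < i <= m)%N -> (m <= n)%N ->
  proj_summand A C m i x = component i x.
Proof.
move=> im mn; have hi : (0 < i <= n)%N by lia.
have li := component_linear hi.
have sk : subspace [set z | setT z /\ component i z = 0].
  exact: subspace_kernel.
apply: (proj_eq li); first by move=> z; apply: component_id.
- move=> _ [z hz [c hc <-]]; rewrite (linear_atD _ _ li).
  rewrite (@component_remainder0 i m c) // addr0.
  suff [] : [set z | setT z /\ component i z = 0] z by [].
  apply: setadd_big_sub hz => // j; rewrite mem_index_iota => hj ji y ay /=.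
  by split=> //; apply: component0 ay => //; lia.
- exact: component_in.
- exists (\sum_(1 <= j < m.+1 | j != i) component j x).
    apply: setadd_big_sum => j; rewrite mem_index_iota => hj _.
    by apply: component_in; lia.
  exists (remainder m x); first exact: remainder_in.
  rewrite [X in _ = X - _](component_sum m).
  rewrite [X in _ = X + _ - _](bigD1_seq i) /=; first last.
  + exact: iota_uniq.
  + rewrite mem_index_iota; lia.
  by rewrite [RHS]addrC -addrA addKr.
Qed.

End Flag.

(** * Linearity of the recursion *)

Section Recursion.
Variables (K : fieldType) (B B' : lmodType K).
Variables (L : nat -> {linear B -> B'}) (D : recursion L).

Local Notation N := (N_ D).
Local Notation Nc := (Nc_ D).
Local Notation R := (R_ D).
Local Notation Rc := (Rc_ D).
Local Notation Sbar := (Sbar_ D).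
Local Notation S := (S_ D).
Local Notation E := (E_ D).
Local Notation M := (M_ D).
Local Notation rem := (remainder R Rc).
Local Notation comp := (component R Rc).

(** Linearity of S_1, ..., S_n is what makes N_j and R_j subspaces for j <= n.
It is assumed in this section, so that it can serve as the induction hypothesis
of [linear_upto_all]. *)
Section Stage.
Variable n : nat.
Hypothesis linS : forall j, (0 < j <= n)%N -> linear (S j).

Lemma stage_subspace_N j : (j <= n)%N -> subspace (N j).
Proof.
elim: j => [_|j IH jn]; first by rewrite N_0.
by rewrite N_succ; apply: subspace_kernel; [apply: IH; lia | exact: linS].
Qed.

Lemma stage_flag_N : flag Nc N n.
Proof.
split=> [|j jn]; first exact: N_0.
have [sNc I0 eW] := Nc_succ D j; split.
- exact: subspace_submod.
- exact: stage_subspace_N.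
- by rewrite setIC.
- rewrite -eW; apply/seteqP; split=> [_ [a aA [c cC <-]]|_ [a aA [c cC <-]]];
    by exists c => //; exists a => //; rewrite addrC.
Qed.

Lemma stage_flag_R : flag R Rc n.
Proof.
split=> [|j jn]; first exact: Rc_0.
have [sRc I0 eW] := Rc_succ D j; split=> //; last exact: subspace_submod.
by rewrite R_succ; apply: subspace_image;
  [apply: stage_subspace_N; lia | exact: linS].
Qed.

Lemma stage_S_Nc i : (0 < i <= n)%N -> S i @` Nc i = R i.
Proof.
case: i => // i hi; rewrite R_succ; have [_ _ <-] := Nc_succ D i.
have [N0 _] := stage_subspace_N (j := i.+1) hi.
apply/seteqP; split=> [_ [x hx <-]|_ [_ [a aN [c cN <-]] <-]].
  by exists x => //; exists 0 => //; exists x => //; rewrite add0r.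
exists c => //; rewrite (linear_atD _ _ (linS hi)).
by move: aN; rewrite N_succ => -[_ ->]; rewrite add0r.
Qed.

Lemma stage_S_inj i x : (0 < i <= n)%N -> Nc i x -> S i x = 0 -> x = 0.
Proof.
case: i => // i hi cx sx; have spl := (stage_flag_N).2 i hi.
apply: (split_sum0 spl) => //; rewrite N_succ; split=> //.
exact: (split_sumL spl).
Qed.

Lemma stage_inv_S (W : lmodType K) (g : W -> B') i : (0 < i <= n)%N ->
  linear g -> (forall x, R i (g x)) ->
  linear (fun x => inv_on (S i) (Nc i) (g x)).
Proof.
move=> hi lg hg; apply: linear_inv_on => //.
- exact: linS.
- exact: (flag_subspaceA stage_flag_N hi).
- by move=> x; apply: stage_S_inj.
- by move=> x; rewrite stage_S_Nc.
Qed.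

Lemma stage_S_remainder x : S n.+1 x = rem n (Sbar n.+1 x).
Proof.
case: (posnP n) => [->|n0]; first exact: S_1.
by rewrite S_succ // (proj_remainder stage_flag_R).
Qed.

Lemma stage_E k i x : n = k.+1 -> (0 < i <= k)%N ->
  E i k.+1 x = - inv_on (S i) (Nc i)
    (comp i (\sum_(i.+1 <= nu < k.+2) Sbar nu (E nu k.+1 x))).
Proof.
move=> e hi; rewrite E_up //; congr (- inv_on _ _ _).
by apply: (proj_summand_component stage_flag_R); lia.
Qed.

(** Column n = k + 1 of E is defined from bottom to top, hence the induction on
the distance from the diagonal. *)
Lemma stage_E_linear k i : n = k.+1 -> (0 < i <= k.+1)%N -> (0 < k)%N ->
  (forall j, (0 < j <= n)%N -> linear (Sbar j)) -> linear (E i k.+1).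
Proof.
move=> e hi k0 linSbar.
have [d hd] := ubnP (k.+1 - i); elim: d i hd hi => // d IH i hd hi.
have [->|ne] := eqVneq i k.+1.
  by apply: (linear_ext (fun x => E_diag D x k0)).
have ik : (0 < i <= k)%N by lia.
apply: (linear_ext (fun x => stage_E x e ik)).
apply/linear_opp/stage_inv_S; first lia; last first.
  by move=> x; apply: (component_in stage_flag_R); lia.
apply: (@linear_compose _ _ _ _ (comp i)).
  by apply: (component_linear stage_flag_R); lia.
apply: linear_sum_nat => nu hnu; apply: linear_compose.
  by apply: linSbar; lia.
by apply: IH; lia.
Qed.

End Stage.

Definition linear_upto n :=
  [/\ forall j, (0 < j <= n)%N -> linear (S j),
      forall j, (0 < j <= n)%N -> linear (Sbar j)
    & forall i j, (0 < i)%N -> (0 < j <= n)%N -> linear (M i j)].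

Lemma linear_upto_all n : linear_upto n.
Proof.
elim: n => [|n [lS lSb lM]]; first by split=> [j|j|i j]; lia.
have lSb1 : linear (Sbar n.+1).
  case: (posnP n) => [->|n0].
    by apply: (linear_ext (Sbar_1 D)) => a x y; rewrite linearP.
  apply: (linear_ext (fun x => Sbar_succ D x n0)).
  apply: linear_sum_nat => r hr.
  apply: linear_compose; first by move=> a x y; rewrite linearP.
  by apply: lM; lia.
have lS1 : linear (S n.+1).
  apply: (linear_ext (stage_S_remainder lS)).
  by apply: linear_compose => //; apply: (remainder_linear (stage_flag_R lS)).
have lSb' j : (0 < j <= n.+1)%N -> linear (Sbar j).
  by have [-> //|ne] := eqVneq j n.+1; move=> hj; apply: lSb; lia.
have lS' j : (0 < j <= n.+1)%N -> linear (S j).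
  by have [-> //|ne] := eqVneq j n.+1; move=> hj; apply: lS; lia.
split=> // i j i0; have [->|ne] := eqVneq j n.+1; last first.
  by move=> hj; apply: lM; lia.
move=> _; have [lt|le] := ltnP n.+1 i.
  have h x : M i n.+1 x = 0 by apply: M_lower; lia.
  by apply: (linear_ext h) => a x y; rewrite scaler0 addr0.
case: (posnP n) => [n0|n0].
  have -> : i = 1%N by lia.
  by rewrite n0; apply: (linear_ext (M_1 D)).
case: i i0 le => // -[_ _|i _ le].
  apply: (linear_ext (fun x => M_first D x n0)).
  by apply: (stage_E_linear lS').
have hi : (0 < i.+1 <= n)%N by lia.
apply: (linear_ext (fun x => M_succ D x hi)); apply: linear_sum_nat => j' hj'.
apply: linear_compose; first by apply: lM; lia.
by apply: (stage_E_linear lS') => //; lia.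
Qed.

Lemma S_linear j : (0 < j)%N -> linear (S j).
Proof. by have [h _ _] := linear_upto_all j => j0; apply: h; lia. Qed.

Lemma M_linear i j : (0 < i)%N -> (0 < j)%N -> linear (M i j).
Proof. by have [_ _ h] := linear_upto_all j => i0 j0; apply: h; lia. Qed.

Let linS n j : (0 < j <= n)%N -> linear (S j).
Proof. by case/andP=> h _; apply: S_linear. Qed.

Lemma flag_N n : flag Nc N n.
Proof. exact: stage_flag_N (@linS n). Qed.

Lemma flag_R n : flag R Rc n.
Proof. exact: stage_flag_R (@linS n). Qed.

(** * Range and kernel relations *)

Lemma N_anti i j : (i <= j)%N -> N j `<=` N i.
Proof. by move=> ij; apply: (flag_anti (flag_N j)); rewrite ij /=. Qed.

Lemma Rc_anti i j : (i <= j)%N -> Rc j `<=` Rc i.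
Proof. by move=> ij; apply: (flag_anti (flag_R j)); rewrite ij /=. Qed.

Lemma Nc_sub_N i j : (i < j)%N -> Nc j `<=` N i.
Proof. by move=> ij; apply: (flag_sub (flag_N j)); rewrite ij /=. Qed.

Lemma S_Nc i : (0 < i)%N -> S i @` Nc i = R i.
Proof. by move=> i0; apply: (stage_S_Nc (@linS i)); lia. Qed.

Lemma S_inj_Nc i x : (0 < i)%N -> Nc i x -> S i x = 0 -> x = 0.
Proof. by move=> i0; apply: (stage_S_inj (@linS i)); lia. Qed.

Lemma S_remainder n x : S n.+1 x = rem n (Sbar n.+1 x).
Proof. exact: stage_S_remainder (@linS n) x. Qed.

Lemma S_in_Rc n x : Rc n (S n.+1 x).
Proof. by rewrite S_remainder; apply: (remainder_in (flag_R n)). Qed.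

Lemma S_N0 i j x : (0 < i <= j)%N -> N j x -> S i x = 0.
Proof.
case: i => // i /andP[_ ij] /(N_anti ij).
by rewrite N_succ => -[].
Qed.

(** * The product formula *)

Lemma E_in_Nc i k x : (0 < i <= k)%N -> Nc i (E i k.+1 x).
Proof.
move=> hi; rewrite (stage_E (@linS k.+1)) //.
have sN : subspace (Nc i) by apply: (flag_subspaceA (flag_N i)); lia.
apply: (subspaceN sN); apply: (inv_onP _).1; rewrite S_Nc; last lia.
by apply: (component_in (flag_R k.+1)); lia.
Qed.

Lemma S_E i k x : (0 < i <= k)%N ->
  S i (E i k.+1 x) =
  - comp i (\sum_(i.+1 <= nu < k.+2) Sbar nu (E nu k.+1 x)).
Proof.
move=> hi; have i0 : (0 < i)%N by lia.
rewrite (stage_E (@linS k.+1)) // -sub0r (linear_atB _ _ (S_linear i0)).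
rewrite (linear_at0 (S_linear i0)) sub0r (inv_onP _).2 //; rewrite S_Nc //.
by apply: (component_in (flag_R k.+1)); lia.
Qed.

Lemma remainder_Sbar_Nc i m x : (0 < i <= m)%N -> Nc i x ->
  rem m (Sbar i x) = 0.
Proof.
case: i => // i hi cx; have lm := remainder_linear (flag_R m) (leqnn m).
rewrite -(@remainder_remainder _ _ _ _ m (flag_R m) i); last lia.
rewrite -S_remainder; apply: (remainder0 (flag_R m) (i := i.+1)) => //.
by rewrite -S_Nc //; exists x.
Qed.

(** The defining property of E: the terms with nu < i have no component in R_i
because Sbar_nu maps N_nu^c into R_1 + ... + R_nu, and E_i is chosen so that
the term nu = i cancels the terms with nu > i. *)
Lemma component_Sbar_E i k x : (0 < i <= k)%N ->
  comp i (\sum_(1 <= nu < k.+2) Sbar nu (E nu k.+1 x)) = 0.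
Proof.
move=> hi; have li : linear (comp i).
  by apply: (component_linear (flag_R i)); lia.
rewrite (@big_cat_nat _ _ _ i) /=; try lia.
rewrite [X in _ + X]big_ltn; last lia.
rewrite !(linear_atD _ _ li) -[X in _ + (_ + X)]opprK -S_E //.
rewrite (linear_at_sum _ _ _ li) big_nat big1 ?add0r.
  rewrite /component (@remainder_Sbar_Nc i i); [|lia|exact: E_in_Nc].
  by case: i hi {li} => // i hi /=; rewrite subr0 -S_remainder subrr.
move=> nu hnu; rewrite /component !remainder_Sbar_Nc ?subrr //; try lia;
  by apply: E_in_Nc; lia.
Qed.

(** By [component_Sbar_E] the sum lies in R_k^c; projecting it there
leaves only the term nu = k + 1, since Sbar_nu E_nu is in R_1 + ... + R_k for
the other ones. *)
Lemma S_Sbar_E k x : (0 < k)%N ->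
  S k.+1 x = \sum_(1 <= nu < k.+2) Sbar nu (E nu k.+1 x).
Proof.
move=> k0; have lk := remainder_linear (flag_R k) (leqnn k).
rewrite [RHS](component_sum R Rc k) big_nat big1 ?add0r; last first.
  by move=> i hi; apply: component_Sbar_E; lia.
rewrite (linear_at_sum _ _ _ lk) big_nat_recr //= E_diag // -S_remainder.
rewrite big_nat big1 ?add0r // => nu hnu.
by apply: remainder_Sbar_Nc; [lia | apply: E_in_Nc; lia].
Qed.

(** The first row of M is that of E and row r + 1 is row r multiplied by the
shifted E; so the right-hand side of [S_Sbar_E], with Sbar expanded as L M, is
this sum after exchanging the summations. *)
Lemma S_column m x : (0 < m)%N ->
  \sum_(0 <= r < m) L r (M r.+1 m x) = S m x.
Proof.
case: m => // k _; case: (posnP k) => [->|k0].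
  by rewrite big_nat1 M_1 S_1 Sbar_1.
rewrite S_Sbar_E // big_ltn // [RHS]big_ltn // M_first // Sbar_1.
congr (_ + _); rewrite [RHS]big_add1 /=.
transitivity (\sum_(1 <= j < k.+1) \sum_(1 <= r < k.+1)
                L r (M r j (E j.+1 k.+1 x))).
  rewrite exchange_big_nat /=; apply: eq_big_nat => r hr.
  by rewrite M_succ ?raddf_sum //; lia.
apply: eq_big_nat => j hj; rewrite Sbar_succ; last lia.
apply: sum_nat_trim; first lia.
by move=> r hr; rewrite M_lower ?raddf0 //; lia.
Qed.

Lemma M_diagonal_step i n x : (0 < i <= n)%N ->
  M i.+1 n.+1 x = M i n x + \sum_(1 <= j < n) M i j (E j.+1 n.+1 x).
Proof.
move=> hi; rewrite M_succ // big_nat_recr; last lia.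
by rewrite /= E_diag; [rewrite addrC | lia].
Qed.

(** When a grows by one, the change of the left-hand side is, by the identity for
the previous a and the size j - a, a sum of terms S_(j-a) y with y in the range
of an entry E_(j+1). These vanish, because N_(j+1)^c lies in N_j and
hence in the kernel of S_(j-a). *)
Lemma S_diagonal a m x : (0 < m)%N ->
  \sum_(0 <= r < m) L r (M (r.+1 + a)%N (m + a)%N x) = S m x.
Proof.
elim: a m x => [|a IH] m x m0.
  by rewrite addn0 -S_column //; apply: eq_big_nat => r _; rewrite addn0.
transitivity (\sum_(0 <= r < m) (L r (M (r.+1 + a)%N (m + a)%N x) +
    \sum_(1 <= j < m + a)
      L r (M (r.+1 + a)%N j (E j.+1 (m + a).+1 x)))).
  apply: eq_big_nat => r hr; rewrite !addnS M_diagonal_step; last lia.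
  by rewrite raddfD raddf_sum.
rewrite big_split /= IH // exchange_big_nat /= big_nat big1 ?addr0 // => j hj.
have yN : N j (E j.+1 (m + a).+1 x).
  by apply: (@Nc_sub_N j j.+1) => //; apply: E_in_Nc; lia.
have [le|lt] := leqP j a.
  by rewrite big_nat big1 // => r hr; rewrite M_lower ?raddf0 //; lia.
rewrite (@sum_nat_trim _ _ (j - a)); first last.
- by move=> r hr; rewrite M_lower ?raddf0 //; lia.
- lia.
have {2}-> : j = (j - a + a)%N by lia.
by rewrite IH; [apply: S_N0 yN; lia | lia].
Qed.

Lemma M_diag i x : (0 < i)%N -> M i i x = x.
Proof.
case: i => // i _; elim: i x => [|i IH] x; first exact: M_1.
rewrite M_diagonal_step; last lia.
rewrite IH big_nat big1 ?addr0 // => j hj; rewrite M_lower //; lia.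
Qed.

(** * Kernel of the transformed series *)

(** Peeling off one splitting at a time: if all coefficients lie in N_m then
S_1, ..., S_m kill them, and the coefficient of order i + m of S n reads
S_(m+1) n_i + (element of R^c_(m+1)) = 0 with S_(m+1) n_i in R_(m+1). *)
Lemma S_series_kernel (n : nat -> B) m i :
  (forall i, ps_app (fun j => S j.+1) n i = 0) -> N m (n i).
Proof.
move=> Sn0; elim: m i => [|m IH] i; first by rewrite N_0.
rewrite N_succ; split=> //.
have := Sn0 (i + m)%N; rewrite /ps_app (@big_cat_nat _ _ _ m) /=; try lia.
rewrite big_nat big1 ?add0r => [|j hj]; last first.
  by apply: (@S_N0 _ m) => //; lia.
rewrite big_ltn; last lia.
rewrite addnK => e.
have spl := (flag_R m.+1).2 m (ltnSn m).
apply: (split_sum0 spl); first by rewrite R_succ; exists (n i).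
have sRc : subspace (Rc m.+1) by apply: (flag_subspace (flag_R m.+1)).
move/eqP: e; rewrite addr_eq0 => /eqP ->.
apply: (subspaceN sRc); rewrite big_nat.
apply: (big_ind (Rc m.+1)); first by case: sRc.
  by move=> x y; apply: subspaceD.
move=> j hj; by apply: (@Rc_anti m.+1 j); [lia | exact: S_in_Rc].
Qed.

(** * Stabilization *)

Section Stable.
Variable k : nat.
Hypothesis R0 : forall l, (2 <= l)%N -> R (k + l)%N = [set 0].

(** S_i is injective on N_i^c and maps it onto R_i = 0. *)
Lemma stable_Nc0 i x : (k.+1 < i)%N -> Nc i x -> x = 0.
Proof.
move=> ki cx; apply: (@S_inj_Nc i) => //; first lia.
have : R i (S i x) by rewrite -S_Nc; [exists x | lia].
have -> : i = (k + (i - k))%N by lia.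
by rewrite R0 //; lia.
Qed.

Lemma stable_N j : (k < j)%N -> N j = N k.+1.
Proof.
move=> kj; apply/seteqP; split; first exact: N_anti.
rewrite -(subnK kj); elim: (j - k.+1)%N => [x //|d IH].
apply: subset_trans IH _ => x nx; rewrite addSn N_succ; split=> //.
have : R (d + k.+1).+1 (S (d + k.+1).+1 x) by rewrite R_succ; exists x.
have -> : (d + k.+1).+1 = (k + d.+2)%N by lia.
by rewrite R0.
Qed.

Lemma stable_S_N0 i x : N k.+1 x -> S i.+1 x = 0.
Proof.
have [le|lt] := leqP i k; first exact: S_N0.
by rewrite -(@stable_N i.+1) ?ltnS ?(ltnW lt) //; apply: S_N0; lia.
Qed.

(** In [M_diagonal_step] only the first term survives: M is upper triangular, and
the entry E_(j+1) is zero for j >= i > k. *)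
Lemma M_stable_step i n x : (k < i)%N -> (0 < n)%N -> M i.+1 n.+1 x = M i n x.
Proof.
move=> ki n0; have [lt|le] := ltnP n i.
  by rewrite !M_lower //; lia.
rewrite M_diagonal_step; last lia.
rewrite big_nat big1 ?addr0 // => j hj.
have [ji|ij] := ltnP j i; first by rewrite M_lower //; lia.
rewrite (@stable_Nc0 j.+1 (E j.+1 n.+1 x)); [|lia|apply: E_in_Nc; lia].
by rewrite linear_at0 //; apply: M_linear; lia.
Qed.

Lemma M_stable a n x : (0 < n)%N ->
  M (k.+1 + a)%N (n + a)%N x = M k.+1 n x.
Proof.
move=> n0; elim: a => [|a IH]; first by rewrite !addn0.
by rewrite !addnS M_stable_step ?IH //; lia.
Qed.

Lemma L_phi i x : ps_comp (fun j => L j) (phi D k) i x = S i.+1 x.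
Proof.
rewrite -(@S_diagonal k) //; apply: eq_big_nat => r hr; congr (L r _).
rewrite /phi -(@M_stable r); last lia.
by congr (M _ _ _); lia.
Qed.

Lemma phi0 x : phi D k 0 x = x.
Proof. by rewrite /phi addn0 M_diag. Qed.

Lemma phi_linear i : linear (phi D k i).
Proof. by apply: M_linear; lia. Qed.

(** The block of psi_j on R_p sends S_p x back to x in N^c_p and then applies
S_(p+j); for j > 0, psi_j vanishes on R^c_(k+1). *)
Definition psi_fun j y :=
  if j is 0 then y else
  \sum_(1 <= p < k.+2) S (p + j)%N (inv_on (S p) (Nc p) (comp p y)).

Lemma psi_linear j : linear (psi_fun j).
Proof.
case: j => [//|j]; apply: linear_sum_nat => p hp.
apply: linear_compose; first by apply: S_linear; lia.
apply: (stage_inv_S (@linS p)); first lia.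
  by apply: (component_linear (flag_R p)); lia.
by move=> y; apply: (component_in (flag_R p)); lia.
Qed.

Lemma psi_S p j x : (0 < p <= k.+1)%N -> Nc p x ->
  psi_fun j (S p x) = S (p + j)%N x.
Proof.
move=> hp cx; case: j => [|j]; first by rewrite addn0.
have Rp : R p (S p x) by rewrite -S_Nc; [exists x | lia].
rewrite /psi_fun (bigD1_seq p) /=; first last.
- exact: (iota_uniq 1 k.+1).
- by rewrite mem_index_iota; lia.
rewrite [X in _ + X]big_seq_cond [X in _ + X]big1 ?addr0.
  rewrite (component_id (flag_R p)) //; last lia.
  have [c e] : Nc p (inv_on (S p) (Nc p) (S p x)) /\
      S p (inv_on (S p) (Nc p) (S p x)) = S p x.
    by apply: inv_onP; exists x.
  have lp : linear (S p) by apply: S_linear; lia.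
  congr (S _ _); apply/eqP; rewrite -subr_eq0; apply/eqP/(@S_inj_Nc p).
  + lia.
  + by apply: subspaceB => //; apply: (flag_subspaceA (flag_N p)); lia.
  + by rewrite (linear_atB _ _ lp) e subrr.
move=> q /andP[]; rewrite mem_index_iota => hq qp.
have lq : linear (S q) by apply: S_linear; lia.
have lqj : linear (S (q + j.+1)) by apply: S_linear; lia.
rewrite (component0 (flag_R k.+1) (j := p)) //; try lia.
suff -> : inv_on (S q) (Nc q) 0 = 0 by rewrite linear_at0.
have [c e] : Nc q (inv_on (S q) (Nc q) 0) /\ S q (inv_on (S q) (Nc q) 0) = 0.
  apply: inv_onP; exists 0; last exact: linear_at0.
  by case: (flag_subspaceA (flag_N q) (m := q)) => //; lia.
by apply: (@S_inj_Nc q) => //; lia.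
Qed.

(** The factor psi_j meets Delta_(i-j) = S_p P_p with p = i - j + 1, and turns
it into S_(i+1) P_p. Hence both sides are the sum of S_(i+1) P_p over p:
the projections with p > i + 1, absent on the right, have values in N_(i+1),
where S_(i+1) vanishes, as it does on N_(k+1). *)
Lemma psi_Delta i x : S i.+1 x = ps_comp psi_fun (Delta D k) i x.
Proof.
pose a p := component Nc N p x.
have aNc p : (0 < p)%N -> Nc p (a p).
  by move=> p0; apply: (component_in (flag_N p)); lia.
have lS : linear (S i.+1) by exact: S_linear.
pose F q := if (q <= k)%N then S i.+1 (a q.+1) else 0.
have F0 q : (minn i k < q)%N -> F q = 0.
  rewrite /F => hq; case: ifP => // qk; apply: (@S_N0 _ q); first lia.
  by apply: (@Nc_sub_N q q.+1) => //; apply: aNc.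
transitivity (\sum_(0 <= q < i.+1) F q); last first.
  rewrite big_nat_rev; apply: eq_big_nat => j hj.
  rewrite /F /Delta add0n subSS; case: ifP => hk; last first.
    by rewrite linear_at0 //; exact: psi_linear.
  rewrite /PN (proj_summand_component (flag_N k.+1)) //.
  rewrite psi_S //; last exact: aNc.
  by congr (S _ _); lia.
rewrite (@sum_nat_trim _ _ (minn i k).+1); first last.
- by move=> q hq; apply: F0; lia.
- lia.
rewrite [x in LHS](component_sum Nc N k.+1) (linear_atD _ _ lS).
rewrite (stable_S_N0 i (remainder_in (flag_N k.+1) x (leqnn _))) addr0.
rewrite (linear_at_sum _ _ _ lS) big_add1 /=.
rewrite -(@sum_nat_trim _ _ (minn i k).+1 k.+1); first last.
- by move=> q hq; apply: F0; lia.
- lia.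
by apply: eq_big_nat => q hq; rewrite /F ifT.
Qed.

End Stable.

End Recursion.

Theorem theorem2 (K : fieldType) (B B' : lmodType K)
    (L : nat -> {linear B -> B'}) (D : recursion L) (k : nat)
    (hstab : stabilizes_at D k) :
  (* (i) *)
  ((forall i, linear (phi D k i)) /\
   (forall i x, ps_comp (fun j => L j) (phi D k) i x = S_ D i.+1 x) /\
   (forall i, (1 <= i <= k.+1)%N ->
      [/\ S_ D i @` (\big[@setadd B/[set 0]]_(0 <= j < i) Nc_ D j)
            `<=` Rc_ D i.-1,
          S_ D i @` Nc_ D i = R_ D i
        & forall x, N_ D i x -> S_ D i x = 0]) /\
   (forall l, (2 <= l)%N ->
      [/\ range (S_ D (k + l)%N) `<=` Rc_ D k.+1,
          (forall x, N_ D k.+1 x -> S_ D (k + l)%N x = 0)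
        & forall j x, (1 <= j <= k.+1)%N -> PR D k j (S_ D (k + l)%N x) = 0]) /\
   (forall i x, N_ D k.+1 x -> S_ D i.+1 x = 0)) /\
  (* (ii) *)
  (forall b : nat -> B, solutions L b ->
     (exists! n : nat -> B,
        (forall i, N_ D k.+1 (n i)) /\
        (forall i, b i = ps_app (phi D k) n i)) /\
     (forall n : nat -> B,
        (forall i, N_ D k.+1 (n i)) ->
        (forall i, b i = ps_app (phi D k) n i) ->
        n 0%N = b 0%N /\
        forall i, (1 <= i)%N ->
          n i = b i - \sum_(1 <= j < i.+1) phi D k j (n (i - j)%N))) /\
  (* (iii) *)
  (solutions L = X_infty D k /\ forall x, phi D k 0 x = x) /\
  (* (iv) *)
  (exists psi : nat -> {linear B' -> B'},
     (forall y, psi 0%N y = y) /\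
     forall i x,
       S_ D i.+1 x = ps_comp (fun j => psi j) (Delta D k) i x).
Proof.
have [_ R0] := hstab; have ph0 := phi0 D k.
have Sser n i : ps_app (fun j => L j) (ps_app (phi D k) n) i =
    ps_app (fun j => S_ D j.+1) n i.
  rewrite ps_app_app; apply: eq_big_nat => j _; exact: L_phi.
have solve b : solutions L b -> exists n : nat -> B,
    (forall i, N_ D k.+1 (n i)) /\ forall i, b i = ps_app (phi D k) n i.
  move=> hb; have [n hn] := ps_app_solve ph0 b; exists n; split=> // i.
  apply: S_series_kernel => m; rewrite -Sser.
  by have := hb m; rewrite (funext hn).
split; last split; last split.
- split; first exact: phi_linear.
  split; first exact: L_phi.
  split=> [[//|i] hi|].
    split=> [_ [x _ <-]||x]; [exact: S_in_Rc | exact: S_Nc |].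
    by apply: S_N0; lia.
  split=> [[//|l] hl|]; last by move=> i x; exact: stable_S_N0.
  have SRc x : Rc_ D k.+1 (S_ D (k + l.+1)%N x).
    rewrite addnS; apply: (@Rc_anti _ _ _ _ _ _ (k + l)%N); first lia.
    exact: S_in_Rc.
  split=> [_ [x _ <-] //|x|j x hj]; first by rewrite addnS; exact: stable_S_N0.
  rewrite /PR (proj_summand_component (flag_R D k.+1)) //.
  by apply: (component_remainder0 (flag_R D k.+1) (m := k.+1)).
- move=> b hb; split.
    have [n [nN nb]] := solve b hb; exists n; split=> // n' [_ nb'].
    by apply: (ps_app_inj ph0) => i; rewrite -nb -nb'.
  move=> n _ nb; split=> [|i _]; rewrite nb ps_app_recl //.
    by rewrite big_geq // addr0.
  by rewrite addrK.
- split=> //; apply/seteqP; split=> [b /solve //|b [n [nN nb]] m].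
  rewrite (funext nb : b = ps_app (phi D k) n) Sser /ps_app big1 // => j _.
  by apply: (stable_S_N0 R0).
- exists (fun j => linear_of (psi_linear D k j)); split=> // i x.
  exact: psi_Delta.
Qed.
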